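(* For integers $r,s\ge0$ with $r+s\ge1$, let $$M_{r,s}=B_{r,s}-\{(0,\ldots,0;0,\ldots,0),(2,\ldots,2;1,\ldots,1)\},\qquad B_{r,s}=P_3^{\square r}\square Q_s,$$ and let $\mathcal A=\{(r,s)\in\mathbb Z_{\ge0}^2: s\ge1,\ 2r+s\ge3\}$. Then $$M_{r,s}\in\mathcal O_{\mathrm D}\iff(r,s)\in\mathcal A.$$ For $(r,s)\in\mathcal A$, $M_{r,s}$ has $|V(M_{r,s})|=3^r2^s-2$ vertices and isometric dimension $\operatorname{idim}(M_{r,s})=2r+s$, and the graphs $M_{r,s}$ with $(r,s)\in\mathcal A$ are pairwise nonisomorphic.
   Context: Graphs are finite and simple; partial cubes are connected (and nonempty) by convention. $P_3$ is the path on three vertices, $Q_s$ the hypercube on $\{0,1\}^s$, $\square$ the Cartesian product, $G^{\square0}=Q_0=K_1$. Coordinate model: $V(B_{r,s})=\{0,1,2\}^r\times\{0,1\}^s$, two vertices being adjacent iff they differ in exactly one coordinate and there by exactly $1$; a semicolon separates the first $r$ coordinates from the last $s$. $B_{r,s}-S$ is the subgraph induced by the vertices not in $S$. A partial cube is a graph isomorphic to an isometric (distance-preserving) subgraph of a hypercube. A daisy cube is a graph isomorphic to the induced subgraph $Q_n[D]$ for some $n\ge0$ and nonempty down-set $D\subseteq\{0,1\}^n$ (coordinatewise order). In a partial cube, $ab\,\Theta\,uv$ iff $d(a,u)+d(b,v)\ne d(a,v)+d(b,u)$; this is an equivalence relation on edges, and each class ($\Theta$-class) determines two complementary halfspaces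 $\{z:d(a,z)<d(b,z)\}$, $\{z:d(b,z)<d(a,z)\}$. The isometric dimension $\operatorname{idim}$ of a partial cube is its number of $\Theta$-classes. A restriction of a partial cube is the subgraph induced by a halfspace of a $\Theta$-class; a contraction is obtained by contracting all edges of one $\Theta$-class (suppressing loops and parallel edges). A pc-minor is any graph obtained by a finite sequence of restrictions and contractions; it is proper if not isomorphic to the original graph. $\mathcal O_{\mathrm D}$ is the set of all partial cubes that are not daisy cubes but all of whose proper pc-minors are daisy cubes. *)

(* Defs.v *)
From mathcomp Require Import all_boot.

Set Implicit Arguments.
Unset Strict Implicit.
Unset Printing Implicit Defensive.

(** * Finite simple graphs *)

Record sgraph := SGraph {
  vertex :> finType;
  adj : rel vertex;
  adj_sym : symmetric adj;
  adj_irr : irreflexive adj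
}.

Definition isomorphic (G H : sgraph) : Prop :=
  exists2 f : G -> H, bijective f & forall x y, adj (f x) (f y) = adj x y.

Definition connected (G : sgraph) : Prop :=
  forall x y : G, connect (@adj G) x y.

Definition walk (G : sgraph) (n : nat) (x y : G) : bool :=
  [exists p : n.-tuple G, path (@adj G) x p && (last x p == y)].

(* The least length of a walk from x to y.  A shortest walk has fewer than
   #|G| edges; the junk value for disconnected x and y is #|G|. *)
Definition dist (G : sgraph) (x y : G) : nat :=
  find (fun n => walk n x y) (iota 0 #|G|).

Section Induced.
Variables (G : sgraph) (D : {set G}).
Definition induced_adj : rel {x : G | x \in D} :=
  fun x y => adj (val x) (val y).
Fact induced_sym : symmetric induced_adj.
Proof. by move=> x y; exact: adj_sym. Qed.
Fact induced_irr : irreflexive induced_adj.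
Proof. by move=> x; exact: adj_irr. Qed.
Definition induced : sgraph := SGraph induced_sym induced_irr.
End Induced.

Section Box.
Variables G H : sgraph.
Definition box_adj : rel (G * H)%type := fun u v =>
  (adj u.1 v.1 && (u.2 == v.2)) || ((u.1 == v.1) && adj u.2 v.2).
Fact box_sym : symmetric box_adj.
Proof.
move=> u v; rewrite /box_adj [adj v.1 _]adj_sym [adj v.2 _]adj_sym.
by rewrite [v.1 == _]eq_sym [v.2 == _]eq_sym.
Qed.
Fact box_irr : irreflexive box_adj.
Proof. by move=> u; rewrite /box_adj !adj_irr andbF. Qed.
Definition box : sgraph := SGraph box_sym box_irr.
End Box.

Section BoxPower.
Variables (G : sgraph) (r : nat).
Definition boxpow_adj : rel {ffun 'I_r -> G} := fun f g =>
  [exists i, adj (f i) (g i) && [forall j, (j != i) ==> (f j == g j)]].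
Fact boxpow_sym : symmetric boxpow_adj.
Proof.
move=> f g; rewrite /boxpow_adj; apply: eq_existsb => i; rewrite adj_sym.
by congr andb; apply: eq_forallb => j; rewrite [f j == _]eq_sym.
Qed.
Fact boxpow_irr : irreflexive boxpow_adj.
Proof. by move=> f; apply/existsP=> -[i]; rewrite adj_irr. Qed.
Definition boxpow : sgraph := SGraph boxpow_sym boxpow_irr.
End BoxPower.

Definition P3_adj : rel 'I_3 := fun i j => (i.+1 == j) || (j.+1 == i).
Fact P3_sym : symmetric P3_adj.
Proof. by move=> i j; rewrite /P3_adj orbC. Qed.
Fact P3_irr : irreflexive P3_adj.
Proof. by move=> i; rewrite /P3_adj orbb; apply/eqP=> /esym/n_Sn. Qed.
Definition P3 : sgraph := SGraph P3_sym P3_irr.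

Section Hypercube.
Variable n : nat.
Definition cube_adj : rel {ffun 'I_n -> bool} := fun x y =>
  #|[set i | x i != y i]| == 1.
Fact cube_sym : symmetric cube_adj.
Proof.
move=> x y; rewrite /cube_adj; congr (#|pred_of_set _| == 1).
by apply/setP=> i; rewrite !inE eq_sym.
Qed.
Fact cube_irr : irreflexive cube_adj.
Proof.
move=> x; rewrite /cube_adj (_ : [set i | _] = set0) ?cards0 //.
by apply/setP=> i; rewrite !inE eqxx.
Qed.
Definition hypercube : sgraph := SGraph cube_sym cube_irr.
End Hypercube.

(** * Partial cubes and daisy cubes *)

(* A distance-preserving f is an isomorphism from G onto an isometric
   subgraph of the hypercube, namely its image. *)
Definition partial_cube (G : sgraph) : Prop :=
  [/\ 0 < #|G|, connected G
    & exists n (f : G -> hypercube n), forall x y, dist (f x) (f y) = dist x y].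

Definition down_set n (D : {set hypercube n}) : Prop :=
  forall x y : hypercube n, y \in D -> (forall i, x i ==> y i) -> x \in D.

Definition daisy_cube (G : sgraph) : Prop :=
  exists n (D : {set hypercube n}),
    [/\ D != set0, down_set D & isomorphic G (induced D)].

(** * Theta-classes, restrictions and contractions *)

Section Theta.
Variable G : sgraph.

(* The Djokovic-Winkler relation between the edges ab and uv; swapping a and b,
   or u and v, does not affect it. *)
Definition theta (a b u v : G) : bool :=
  dist a u + dist b v != dist a v + dist b u.

Definition edges : {set {set G}} :=
  [set [set p.1; p.2] | p : G * G & adj p.1 p.2].

Definition edge_theta (e f : {set G}) : bool :=
  [exists p : G * G, exists q : G * G,
    [&& e == [set p.1; p.2], f == [set q.1; q.2] & theta p.1 p.2 q.1 q.2]].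

Definition theta_classes : {set {set {set G}}} :=
  equivalence_partition edge_theta edges.

Definition idim : nat := #|theta_classes|.

Definition halfspace (a b : G) : {set G} := [set z | dist a z < dist b z].

(* The vertices of the contraction are the connected components of the
   spanning subgraph of G whose edges are those in the class of ab. *)
Section Contraction.
Variables a b : G.
Definition class_adj : rel G := fun x y => adj x y && theta a b x y.
Definition contr_parts : {set {set G}} :=
  equivalence_partition (connect class_adj) [set: G].
Definition contr_adj : rel {X : {set G} | X \in contr_parts} := fun X Y =>
  (X != Y) && [exists x in val X, exists y in val Y, adj x y].
Fact contr_sym : symmetric contr_adj.
Proof.
move=> X Y; rewrite /contr_adj eq_sym; congr andb.
apply/existsP/existsP=> -[x /andP[Xx /existsP[y /andP[Yy xy]]]];
  by exists y; rewrite Yy; apply/existsP; exists x; rewrite Xx adj_sym.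
Qed.
Fact contr_irr : irreflexive contr_adj.
Proof. by move=> X; rewrite /contr_adj eqxx. Qed.
Definition contraction : sgraph := SGraph contr_sym contr_irr.
End Contraction.

(* Both halfspaces of the class of ab arise, as halfspace a b and
   halfspace b a. *)
Definition restriction (a b : G) : sgraph := induced (halfspace a b).

End Theta.

(** * Partial-cube minors *)

Inductive pc_minor (G : sgraph) : sgraph -> Prop :=
| pc_minor_refl : pc_minor G G
| pc_minor_restriction (H : sgraph) (a b : H) :
    pc_minor G H -> adj a b -> pc_minor G (restriction a b)
| pc_minor_contraction (H : sgraph) (a b : H) :
    pc_minor G H -> adj a b -> pc_minor G (contraction a b).

Definition O_D (G : sgraph) : Prop :=
  [/\ partial_cube G, ~ daisy_cube G
    & forall H, pc_minor G H -> ~ isomorphic H G -> daisy_cube H].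

(** * The graphs M_{r,s} *)

Section M.
Variables r s : nat.

Definition B : sgraph := box (boxpow P3 r) (hypercube s).

Definition B_bot : B := ([ffun=> ord0], [ffun=> false]).
Definition B_top : B := ([ffun=> ord_max], [ffun=> true]).

Definition M : sgraph := induced (~: [set B_bot; B_top]).

End M.

Definition inA (r s : nat) : Prop := 1 <= s /\ 3 <= 2 * r + s.

(* Main.v *)
Require Import Defs.
From mathcomp Require Import all_boot.
From mathcomp Require Import zify.

(** Encoding the three vertices of $P_3$ as 00, 10, 11 puts $B_{r,s}$ inside the
    hypercube on $2r+s$ coordinates, as the set of vectors satisfying one
    implication for each factor $P_3$.  The two removed corners become the two
    constant vectors.  So [M r s] is the cube subgraph induced by the set [Mset]
    of non-constant vectors of this kind, and the whole proof is about sets of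
    boolean vectors.

    In such a picture distances are Hamming distances as soon as, from any
    vector of the set, one can step inside the set towards any other
    ([geodesic], [dist_ham]).  Then the Theta-class of an edge is the coordinate
    it flips, a restriction fixes a coordinate, and a contraction forgets one
    ([coordinates_restriction], [coordinates_contraction]).

    A daisy cube is a set that contains, for some base [b], every vector between
    [b] and one of its members ([star]).  This property is preserved when a
    coordinate is fixed or forgotten, so daisy cubes are closed under pc-minors;
    hence it is enough to look at the minors one step below [M r s]
    ([pc_minor_daisy]).  For a minor of either kind a base is
    given explicitly: its $P_3$-coordinates are at the middle vertex, and its
    hypercube coordinates are opposite to the constant vector that could
    otherwise be reached ([Mset_restriction], [Mset_contraction]).

    Conversely being a daisy cube forces a base in whatever isometric
    coordinates are given, because the number of vertices lying between two
    vertices is a graph invariant ([daisy_star]).  When $s \ge 1$, [Mset] has no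
    base: a hypercube coordinate of the base agrees with one of the two removed
    corners, and that corner lies between the base and a surviving neighbour of
    it ([Mset_not_star]).  When $s = 0$ the all-middle vertex is a base, and the
    remaining pairs with $2r+s < 3$ give an empty or a disconnected graph.

    The isometric dimension is the number of coordinates, all of which are
    flipped by some edge; and $3^r 2^s$ determines $r$ and $s$. *)

Set Implicit Arguments.
Unset Strict Implicit.
Unset Printing Implicit Defensive.

(** * Boolean vectors and the Hamming distance *)

Section Cube.
Variable I : finType.
Implicit Types (u v x y z : {ffun I -> bool}) (i j : I) (D : {set {ffun I -> bool}}).

Definition ham x y : nat := #|[set i | x i != y i]|.

Definition flip x i : {ffun I -> bool} := [ffun j => x j (+) (j == i)].

(** Forgetting a coordinate is modelled by clearing it, so that contractions keep
    the index type. *)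
Definition proj i x : {ffun I -> bool} := [ffun j => (j != i) && x j].

Definition between x y z : bool := [forall i, (z i == x i) || (z i == y i)].

(** A local form of being isometric: iterating the step yields, inside [D], a
    path from [x] to [y] of length [ham x y]. *)
Definition geodesic D : Prop := forall x y, x \in D -> y \in D -> x != y ->
  exists2 i, x i != y i & flip x i \in D.

(** Adding [b] modulo 2 in each coordinate turns [star b D] into the condition
    that [D] is a down-set; keeping [b] as a parameter avoids the translation. *)
Definition star b D : Prop := forall x y, x \in D -> between b x y -> y \in D.

Lemma flipE x i j : flip x i j = x j (+) (j == i).
Proof. by rewrite ffunE. Qed.

Lemma flipK i : involutive (flip^~ i).
Proof. by move=> x; apply/ffunP=> j; rewrite !flipE -addbA addbb addbF. Qed.

Lemma flip_neq x i : flip x i != x.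
Proof. by apply/eqP=> /ffunP/(_ i); rewrite flipE eqxx; case: (x i). Qed.

Lemma projE i x j : proj i x j = (j != i) && x j.
Proof. by rewrite ffunE. Qed.

Lemma proj_flip i x : proj i (flip x i) = proj i x.
Proof. by apply/ffunP=> j; rewrite !projE flipE; case: (j == i) (x j) => -[]. Qed.

Lemma proj_flip_neq i j x : j != i -> proj i (flip x j) = flip (proj i x) j.
Proof.
move=> nji; apply/ffunP=> k; rewrite !(projE, flipE).
by have [->|//] := eqVneq k i; rewrite eq_sym (negbTE nji).
Qed.

Lemma proj_eq_off i j x y : proj i x = proj i y -> j != i -> x j = y j.
Proof. by move=> /ffunP/(_ j); rewrite !projE => /[swap] ->. Qed.

Lemma proj_eq i x y : proj i x = proj i y -> x i = y i -> x = y.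
Proof.
move=> pxy xyi; apply/ffunP=> j; have [->//|] := eqVneq j i.
exact: proj_eq_off.
Qed.

Lemma proj_eq_flip i x y : proj i x = proj i y -> x i != y i -> y = flip x i.
Proof.
move=> pxy xyi; apply: (@proj_eq i); first by rewrite proj_flip.
by rewrite flipE eqxx; case: (x i) (y i) xyi => -[].
Qed.

Lemma ham_sum x y : ham x y = \sum_i (x i != y i).
Proof.
rewrite /ham -sum1_card big_mkcond /=; apply: eq_bigr => i _.
by rewrite inE; case: (_ != _).
Qed.

Lemma hamC x y : ham x y = ham y x.
Proof. by rewrite !ham_sum; apply: eq_bigr => i _; rewrite eq_sym. Qed.

Lemma ham_eq0 x y : (ham x y == 0) = (x == y).
Proof.
rewrite ham_sum sum_nat_eq0; apply/forallP/eqP=> [xy|-> i]; last by rewrite eqxx.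
by apply/ffunP=> i; have := xy i; rewrite /= eqb0 negbK => /eqP.
Qed.

Lemma hamxx x : ham x x = 0.
Proof. by apply/eqP; rewrite ham_eq0. Qed.

Lemma ham_step x y i : x i != y i -> ham x y = (ham (flip x i) y).+1.
Proof.
move=> xyi; rewrite /ham (cardsD1 i) inE xyi add1n; congr _.+1.
apply: eq_card => j; rewrite !inE flipE.
by have [->|_] := eqVneq j i; [case: (x i) (y i) xyi => -[] | rewrite addbF].
Qed.

Lemma ham_step_away x y i : x i = y i -> ham (flip x i) y = (ham x y).+1.
Proof.
by move=> xyi; rewrite (@ham_step _ _ i) ?flipK // flipE eqxx xyi; case: (y i).
Qed.

Lemma ham_flip x i : ham x (flip x i) = 1.
Proof.
by rewrite hamC ham_step_away ?hamxx.
Qed.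

Lemma ham1P x y : reflect (exists i, y = flip x i) (ham x y == 1).
Proof.
apply: (iffP idP) => [/cards1P[i xy]|[i ->]]; last by rewrite ham_flip.
exists i; apply/ffunP=> j; move/setP/(_ j): xy; rewrite !inE flipE => <-.
by case: (x j) (y j) => -[].
Qed.

Lemma ham_triangle x y z : ham x z <= ham x y + ham y z.
Proof.
rewrite !ham_sum -big_split /=; apply: leq_sum => i _.
by case: (x i) (y i) (z i) => -[] [].
Qed.

Lemma ham_between x y z : (ham x z + ham z y == ham x y) = between x y z.
Proof.
rewrite eq_sym !ham_sum -big_split /=.
have [|_ ->] := @leqif_sum _ predT (fun i => (z i == x i) || (z i == y i))
  (fun i => (x i != y i) : nat) (fun i => (x i != z i) + (z i != y i)).
  by move=> i _; case: (x i) (y i) (z i) => -[] []; split.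
by apply: eq_forallb.
Qed.

(** Independently in each coordinate, a vector between [x] and [y] has one
    choice where they agree and two where they differ. *)
Lemma card_between x y : #|[set z | between x y z]| = 2 ^ ham x y.
Proof.
rewrite (_ : [set z | between x y z] =
  [set z | z \in family (fun i => pred2 (x i) (y i))]).
  rewrite cardsE card_family foldrE big_map big_enum /= ham_sum expn_sum.
  by apply: eq_bigr => i _; rewrite card2; case: (x i) (y i) => -[].
by apply/setP=> z; rewrite !inE.
Qed.

Lemma geodesicT : geodesic setT.
Proof.
move=> x y _ _; rewrite -ham_eq0 -lt0n => /card_gt0P[i]; rewrite inE => xyi.
by exists i; rewrite ?inE.
Qed.

(** A walk from [x] to [y] in [D] may first move the coordinates of [x] back to
    those of [b]; once none of the differing coordinates of [x] can do so, [x] is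
    itself between [b] and [y], and so is every vector between [x] and [y]. *)
Lemma star_geodesic b D : star b D -> geodesic D.
Proof.
move=> st x y Dx Dy xy.
have [/existsP[i /andP[xyi xbi]]|] := boolP [exists i, (x i != y i) && (x i != b i)].
  exists i => //; apply: st Dx _; apply/forallP=> j; rewrite flipE.
  have [->|_] := eqVneq j i; last by rewrite addbF eqxx orbT.
  by case: (x i) (b i) xbi => -[].
rewrite negb_exists => /forallP xb.
have [i xyi _] := geodesicT (in_setT x) (in_setT y) xy.
exists i => //; apply: st Dy _; apply/forallP=> j; rewrite flipE.
have := xb j; rewrite negb_and !negbK.
have [->|_] := eqVneq j i; last by rewrite addbF orbC.
by case: (x i) (y i) (b i) xyi => -[] [].
Qed.

(** On a shortest walk from [x] to [y] inside [D], coordinate [i] flips. *)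
Lemma geodesic_flip D x y i : geodesic D -> x \in D -> y \in D -> x i != y i ->
  exists2 z, z \in D & flip z i \in D.
Proof.
move=> gD; have [n] := ubnP (ham x y); elim: n x => // n IHn x lt_n Dx Dy xyi.
have [|j xyj Dxj] := gD x y Dx Dy; first by apply: contraNneq xyi => ->.
have [eij|nij] := eqVneq i j; first by exists x; rewrite // eij.
apply: (IHn (flip x j)) => //; first by rewrite -ltnS -ham_step.
by rewrite flipE (negbTE nij) addbF.
Qed.

Lemma star_restriction b D i e :
  star b D -> star [ffun j => if j == i then e else b j] [set x in D | x i == e].
Proof.
move=> st x y; rewrite !inE => /andP[Dx /eqP xi] /forallP bxy.
have yi : y i = e by have := bxy i; rewrite ffunE eqxx xi orbb => /eqP.
rewrite yi eqxx andbT; apply: st Dx _; apply/forallP=> j.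
have [->|nji] := eqVneq j i; first by rewrite yi xi eqxx orbT.
by have := bxy j; rewrite ffunE (negbTE nji).
Qed.

Lemma star_contraction b D i : star b D -> star (proj i b) (proj i @: D).
Proof.
move=> st _ y /imsetP[x Dx ->] /forallP bxy.
have yi : ~~ y i by have := bxy i; rewrite !projE eqxx orbb => /eqP->.
apply/imsetP; exists [ffun j => if j == i then b i else y j].
  apply: st Dx _; apply/forallP=> j; rewrite ffunE.
  have [->|nji] := eqVneq j i; first by rewrite eqxx.
  by have := bxy j; rewrite !projE nji.
apply/ffunP=> j; rewrite projE ffunE.
by have [->|] := eqVneq j i; first by rewrite (negbTE yi).
Qed.

End Cube.

(** * Graphs in coordinates: distances and the Theta relation *)

Section Coordinates.
Variables (I : finType) (G : sgraph).
Implicit Types (D : {set {ffun I -> bool}}) (c : G -> {ffun I -> bool}).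

(** [c] is an isomorphism from [G] onto the cube subgraph induced by [D], for an
    arbitrary finite index type of coordinates. *)
Definition coordinates D c : Prop :=
  [/\ injective c, forall a b, adj a b = (ham (c a) (c b) == 1) & codom c =i D].

Variables (D : {set {ffun I -> bool}}) (c : G -> {ffun I -> bool}).
Hypotheses (cD : coordinates D c) (gD : geodesic D).

Lemma coord_inj : injective c. Proof. by case: cD. Qed.

Lemma coord_in a : c a \in D.
Proof. by case: cD => _ _ <-; exact: codom_f. Qed.

Lemma coord_onto x : x \in D -> exists a, x = c a.
Proof. by case: cD => _ _ <- /codomP. Qed.

Lemma coord_adj a b : reflect (exists i, c b = flip (c a) i) (adj a b).
Proof. by case: cD => _ -> _; exact: ham1P. Qed.

Lemma walk_ham p a : path (@adj G) a p -> ham (c a) (c (last a p)) <= size p.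
Proof.
elim: p a => [|b p IHp] a /=; first by rewrite hamxx.
case/andP=> /coord_adj[i cb] /IHp le_p.
apply: leq_trans (ham_triangle _ (c b) _) _.
by rewrite cb ham_flip -cb add1n.
Qed.

Lemma geodesic_walk a b : exists p,
  [/\ path (@adj G) a p, last a p = b & size p = ham (c a) (c b)].
Proof.
have [n] := ubnP (ham (c a) (c b)); elim: n a => // n IHn a lt_n.
have [->|ab] := eqVneq a b; first by exists [::]; rewrite hamxx.
have [|i ci Di] := gD (coord_in a) (coord_in b); first by rewrite (inj_eq coord_inj).
have [z cz] := coord_onto Di; have hs := ham_step ci.
have [|p [pz lb sp]] := IHn z; first by rewrite -cz -ltnS -hs.
exists (z :: p); split => //=; last by rewrite sp hs cz.
by rewrite pz andbT; apply/coord_adj; exists i.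
Qed.

Lemma coord_connected : connected G.
Proof.
by move=> a b; have [p [pa <- _]] := geodesic_walk a b; apply/connectP; exists p.
Qed.

(** A shortest walk repeats no vertex, so its length stays below [#|G|], the
    range in which [dist] looks for it. *)
Lemma dist_ham a b : dist a b = ham (c a) (c b).
Proof.
have [p [pa lb sp]] := geodesic_walk a b.
have walkP n : reflect (exists p, [/\ path (@adj G) a p, last a p = b & size p = n])
                       (walk n a b).
  apply: (iffP existsP) => [[q /andP[qa /eqP lq]]|[q [qa lq /eqP sq]]].
    by exists q; rewrite size_tuple.
  by exists (Tuple sq); rewrite /= qa lq eqxx.
have lt_G : ham (c a) (c b) < #|G|.
  case/shortenP: pa (lb) => q qa uq _ lq.
  rewrite -lq (leq_ltn_trans (walk_ham qa)) //.
  by rewrite -[(size q).+1]/(size (a :: q)) -(card_uniqP uq) max_card.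
have hwalk : has (fun n => walk n a b) (iota 0 #|G|).
  apply/hasP; exists (ham (c a) (c b)); first by rewrite mem_iota.
  by apply/walkP; exists p.
have lt_d := hwalk; rewrite has_find size_iota -/(dist a b) in lt_d.
have := nth_find 0 hwalk; rewrite -/(dist a b) nth_iota // add0n.
case/walkP=> q [qa lq sq]; have le_d := walk_ham qa; rewrite lq sq in le_d.
apply/eqP; rewrite eqn_leq le_d andbT.
rewrite leqNgt; apply/negP=> lt_h; have := before_find 0 lt_h.
by rewrite nth_iota // add0n => /walkP[]; exists p.
Qed.

(** Flipping coordinate [i] moves [a] one step closer to or further from a
    vertex according to the value of that vertex at [i] alone. *)
Lemma theta_coord a b u v i :
  c b = flip (c a) i -> theta a b u v = (c u i != c v i).
Proof.
move=> cb; rewrite /theta !dist_ham cb.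
have h w : ham (flip (c a) i) (c w) + (c a i != c w i)
         = ham (c a) (c w) + (c a i == c w i).
  have [e|ne] := eqVneq (c a i) (c w i); first by rewrite ham_step_away // addn0 addn1.
  by rewrite addn1 addn0 -ham_step.
have := h u; have := h v.
set p := ham _ (c u); set q := ham _ (c v); set p' := ham _ (c u); set q' := ham _ (c v).
case: (c a i) (c u i) (c v i) => -[] [] /=; rewrite !addn0 ?addn1 => qq pp;
  by apply/eqP; lia.
Qed.

End Coordinates.

(** * Restrictions and contractions in coordinates *)

Lemma coordinates_isomorphic (I : finType) (G H : sgraph) (D : {set {ffun I -> bool}})
    (c : G -> {ffun I -> bool}) :
  isomorphic H G -> coordinates D c ->
  exists c' : H -> {ffun I -> bool}, coordinates D c'.
Proof.
case=> f [g fK gK] adj_f [c_inj c_adj cD]; exists (c \o f); split.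
- by apply: inj_comp c_inj (can_inj fK).
- by move=> x y; rewrite -adj_f c_adj.
move=> u; rewrite -cD; apply/codomP/codomP=> [[x ->]|[x ->]]; first by exists (f x).
by exists (g x); rewrite /= gK.
Qed.

Lemma coordinates_hypercube n : @coordinates 'I_n (hypercube n) setT id.
Proof.
split=> // u; rewrite inE; by apply/codomP; exists u.
Qed.

Lemma coordinates_induced (I : finType) (G : sgraph) (D E : {set {ffun I -> bool}})
    (c : G -> {ffun I -> bool}) (A : {set G}) :
  coordinates D c -> (forall a, (a \in A) = (c a \in E)) ->
  coordinates (D :&: E) (fun a : induced A => c (val a)).
Proof.
move=> [c_inj c_adj cD] AE; split.
- by move=> a b /c_inj/val_inj.
- by move=> a b; exact: c_adj.
move=> u; rewrite inE -cD; apply/codomP/andP=> [[[a Aa] ->]|[/codomP[a ->] Ea]].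
  by rewrite codom_f -AE.
by rewrite -AE in Ea; exists (exist _ a Ea).
Qed.

Section Minors.
Variables (I : finType) (G : sgraph) (D : {set {ffun I -> bool}}).
Variable c : G -> {ffun I -> bool}.
Hypotheses (cD : coordinates D c) (gD : geodesic D).
Variables (a b : G) (i : I).
Hypothesis cb : c b = flip (c a) i.

Lemma halfspace_coord z : (z \in halfspace a b) = (c z i == c a i).
Proof.
rewrite inE !(dist_ham cD gD) cb; have [e|ne] := eqVneq (c z i) (c a i).
  by rewrite ham_step_away // ltnSn.
by rewrite [ham (c a) _](@ham_step _ _ _ i) 1?eq_sym // ltnNge leqnSn.
Qed.

Lemma coordinates_restriction :
  coordinates [set x in D | x i == c a i] (fun z : restriction a b => c (val z)).
Proof.
rewrite setIdE; apply: coordinates_induced cD _ => z.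
by rewrite halfspace_coord inE.
Qed.

(** Only one coordinate may change along edges of the class of [ab], so the
    components of that class are single vertices and single edges. *)
Lemma connect_class x y :
  connect (class_adj a b) x y = (proj i (c x) == proj i (c y)).
Proof.
have class_flip u v : class_adj a b u v -> c v = flip (c u) i.
  case/andP=> /(coord_adj cD)[j cv]; rewrite (theta_coord cD gD _ _ cb) cv flipE.
  by have [->//|_] := eqVneq i j; rewrite addbF eqxx.
apply/connectP/eqP=> [[p pa ->]|pxy].
  elim: p x pa => //= z p IHp x /andP[/class_flip cz /IHp <-].
  by rewrite cz proj_flip.
have [xyi|xyi] := eqVneq (c x i) (c y i).
  by exists [::]; rewrite //= (coord_inj cD (proj_eq pxy xyi)).
exists [:: y]; rewrite //= andbT /class_adj (theta_coord cD gD _ _ cb) xyi andbT.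
by apply/(coord_adj cD); exists i; exact: proj_eq_flip.
Qed.

(* The default [a] is never reached, as the parts are nonempty. *)
Let contr_coord (X : contraction a b) : {ffun I -> bool} :=
  proj i (c (odflt a [pick x in val X])).

Let contr_part (x : G) : contraction a b :=
  exist _ [set y in setT | connect (class_adj a b) x y] (imset_f _ (in_setT x)).

Let mem_part x y : (y \in val (contr_part x)) = (proj i (c x) == proj i (c y)).
Proof. by rewrite !inE connect_class. Qed.

Let partP (X : contraction a b) : exists x, X = contr_part x.
Proof.
case: X => X PX; have /imsetP[x _ defX] := PX.
by exists x; apply/val_inj; rewrite /= defX.
Qed.

Let contr_coordE x : contr_coord (contr_part x) = proj i (c x).
Proof.
rewrite /contr_coord; case: pickP => [y|/(_ x)]; rewrite mem_part ?eqxx //.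
by move/eqP.
Qed.

(** Two vectors of [D] whose projections differ in one coordinate [j] may still
    differ in [i] as well; the step from one to the other that [geodesic]
    provides then exhibits adjacent representatives. *)
Lemma coordinates_contraction :
  exists c' : contraction a b -> {ffun I -> bool}, coordinates (proj i @: D) c'.
Proof.
exists contr_coord.
have contr_inj : injective contr_coord.
  move=> X Y; have [x ->] := partP X; have [y ->] := partP Y.
  rewrite !contr_coordE => pxy; apply/val_inj/setP=> z.
  by rewrite !mem_part pxy.
split=> //; last first.
  move=> u; apply/codomP/imsetP=> [[X ->]|[v Dv ->]].
    have [x ->] := partP X; exists (c x); last exact: contr_coordE.
    exact: coord_in cD x.
  have [x ->] := coord_onto cD Dv.
  by exists (contr_part x); rewrite contr_coordE.
move=> X Y; have [x defX] := partP X; have [y defY] := partP Y.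
have adjE : adj X Y = (X != Y) && [exists x in val X, exists y in val Y, adj x y] by [].
rewrite adjE {adjE}; apply/andP/ham1P.
  case=> XY /existsP[x' /andP[Xx' /existsP[y' /andP[Yy' xy']]]].
  have [j cy'] := coord_adj cD _ _ xy'; exists j.
  move: Xx' Yy'; rewrite defX defY !contr_coordE !mem_part => /eqP px /eqP py.
  rewrite px py cy' proj_flip_neq //; apply: contraNneq XY => eji.
  apply/eqP/contr_inj; rewrite defX defY !contr_coordE px py cy' eji.
  by rewrite proj_flip.
case=> j; rewrite defX defY !contr_coordE => cXY.
have nji : j != i.
  apply/eqP=> eji; move/ffunP/(_ i): cXY.
  by rewrite flipE !projE eji eqxx.
rewrite -proj_flip_neq // in cXY; split.
  apply: contraTneq isT => eXY; move/(congr1 contr_coord): eXY.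
  rewrite !contr_coordE cXY proj_flip_neq // => /eqP.
  by rewrite eq_sym (negbTE (flip_neq _ _)).
have adjXY x' y' : c x' = c x \/ c x' = flip (c x) i ->
    c y' = flip (c x') j -> 
    [exists x1 in val (contr_part x), exists y1 in val (contr_part y), adj x1 y1].
  move=> cx' cy'; apply/existsP; exists x'; rewrite mem_part.
  apply/andP; split; first by case: cx' => ->; rewrite ?proj_flip.
  apply/existsP; exists y'; rewrite mem_part cXY.
  apply/andP; split; last by apply/(coord_adj cD); exists j.
  by rewrite cy'; case: cx' => ->; rewrite !(proj_flip_neq _ nji) ?proj_flip.
have [xyi|xyi] := eqVneq (c x i) (c y i).
  apply: (adjXY x y); first by left.
  by apply: (proj_eq cXY); rewrite flipE eq_sym (negbTE nji) addbF.
have [|k xyk Dk] := gD (coord_in cD x) (coord_in cD y).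
  by apply: contraNneq xyi => ->.
have [z cz] := coord_onto cD Dk.
have [eki|nki] := eqVneq k i.
  apply: (adjXY z y); first by right; rewrite -cz eki.
  apply: (proj_eq (i := i)); 
    first by rewrite cXY -cz eki !(proj_flip_neq _ nji) proj_flip.
  rewrite -cz eki !flipE eqxx eq_sym (negbTE nji) addbF.
  by case: (c x i) (c y i) xyi => -[].
apply: (adjXY x z); first by left.
have <- : k = j; last by [].
move: xyk; rewrite (proj_eq_off cXY nki) flipE.
by have [->//|_] := eqVneq k j; rewrite addbF eqxx.
Qed.
End Minors.

(** * Daisy cubes *)

Section Recoordinatize.
Variables (I : finType) (b : {ffun I -> bool}).

(** The index type becomes an ordinal, as in [hypercube], and the
    base [b] becomes the zero vector. *)
Definition shift (x : {ffun I -> bool}) : hypercube #|I| :=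
  [ffun k => x (enum_val k) (+) b (enum_val k)].

Lemma shift_enum_rank x i : shift x (enum_rank i) = x i (+) b i.
Proof. by rewrite ffunE enum_rankK. Qed.

Lemma ham_shift x y : ham (shift x) (shift y) = ham x y.
Proof.
rewrite /ham -[RHS](card_imset _ enum_rank_inj); apply: eq_card => k.
rewrite -(enum_valK k) (mem_imset _ _ enum_rank_inj) !inE !shift_enum_rank.
by case: (x _) (y _) (b _) => -[] [].
Qed.

End Recoordinatize.

Lemma partial_cube_coordinates (I : finType) (G : sgraph) (D : {set {ffun I -> bool}})
    (c : G -> {ffun I -> bool}) :
  coordinates D c -> geodesic D -> 0 < #|G| -> partial_cube G.
Proof.
move=> cD gD G_gt0; split=> //; first exact: coord_connected cD gD.
exists #|I|, (fun x => shift [ffun=> false] (c x)) => x y.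
by rewrite (dist_ham (coordinates_hypercube _) (@geodesicT _)) ham_shift (dist_ham cD gD).
Qed.

Lemma daisy_of_star (I : finType) (G : sgraph) (D : {set {ffun I -> bool}})
    (c : G -> {ffun I -> bool}) b :
  coordinates D c -> star b D -> 0 < #|G| -> daisy_cube G.
Proof.
move=> cD stD /card_gt0P[v _].
pose E : {set hypercube #|I|} := [set shift b x | x in D].
have Ec x : shift b (c x) \in E by apply: imset_f; exact: coord_in cD x.
exists #|I|, E; split.
- by apply/set0Pn; exists (shift b (c v)).
- move=> x _ /imsetP[y Dy ->] le_xy.
  pose z := [ffun i => x (enum_rank i) (+) b i].
  have -> : x = shift b z.
    by apply/ffunP=> k; rewrite !ffunE enum_valK -addbA addbb addbF.
  apply: imset_f; apply: stD Dy _; apply/forallP=> i; rewrite ffunE.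
  by have := le_xy (enum_rank i); rewrite shift_enum_rank;
    case: (x _) (y i) (b i) => -[] [].
pose f x : induced E := exist _ (shift b (c x)) (Ec x).
have adj_f x y : adj (f x) (f y) = adj x y.
  by case: (cD) => _ -> _; rewrite -(ham_shift b).
exists f => //; apply: inj_card_bij.
  move=> x y /(congr1 val) /= exy; apply: (coord_inj cD); apply/eqP.
  by rewrite -ham_eq0 -(ham_shift b) exy hamxx.
rewrite card_sig -(card_codom (coord_inj cD)).
by case: cD => _ _ /eq_card ->; exact: leq_imset_card.
Qed.

Lemma star_of_daisy G : daisy_cube G ->
  exists n (D : {set {ffun 'I_n -> bool}}) (c : G -> {ffun 'I_n -> bool}),
    [/\ coordinates D c, star [ffun=> false] D & [ffun=> false] \in D].
Proof.
case=> n [D [/set0Pn[x0 Dx0] downD [f bij_f adj_f]]].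
have [g fK gK] := bij_f.
exists n, D, (val \o f); split.
- split; first exact: inj_comp val_inj (bij_inj bij_f).
    by move=> x y; rewrite -adj_f.
  move=> u; apply/codomP/idP=> [[x ->]|Du]; first exact: valP (f x).
  by exists (g (exist _ u Du)); rewrite /= gK.
- move=> x y Dx /forallP y_le; apply: downD Dx _ => i.
  by have := y_le i; rewrite ffunE; case: (x i) (y i) => -[].
by apply: downD Dx0 _ => i; rewrite ffunE.
Qed.

(** The graph alone determines the number of vertices on geodesics between two
    vertices [v] and [x]; it is at most [2 ^ dist v x] in any coordinates, with
    equality exactly when every vector between theirs is present.  Take for [v]
    the zero vector of daisy coordinates, where equality holds for every [x]. *)
Lemma daisy_star (I : finType) (G : sgraph) (D : {set {ffun I -> bool}})
    (c : G -> {ffun I -> bool}) :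
  coordinates D c -> geodesic D -> daisy_cube G -> exists b, star b D.
Proof.
move=> cD gD /star_of_daisy[n [E [d [dE stE E0]]]].
have gE := star_geodesic stE; have [v dv] := coord_onto dE E0.
exists (c v) => x y Dx; have [w cw] := coord_onto cD Dx; rewrite {}cw => vwy.
pose J := [set z | dist v z + dist z w == dist v w].
have cJ z : (z \in J) = between (c v) (c w) (c z).
  by rewrite inE !(dist_ham cD gD) ham_between.
have dJ z : (z \in J) = between (d v) (d w) (d z).
  by rewrite inE !(dist_ham dE gE) ham_between.
have card_J : #|J| = 2 ^ dist v w.
  rewrite (dist_ham dE gE) -card_between -(card_imset _ (coord_inj dE)).
  apply: eq_card => u; rewrite inE; apply/imsetP/idP=> [[z Jz ->]|vwu].
    by rewrite -dJ.
  have Eu : u \in E by apply: stE (coord_in dE w) _; rewrite dv.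
  by have [z dz] := coord_onto dE Eu; exists z; rewrite // dJ -dz.
have : y \in [set z | between (c v) (c w) z] by rewrite inE.
have /eqP <- : c @: J == [set z | between (c v) (c w) z].
  rewrite eqEcard card_between -(dist_ham cD gD) -card_J.
  rewrite (card_imset _ (coord_inj cD)) leqnn andbT.
  by apply/subsetP=> _ /imsetP[z Jz ->]; rewrite inE -cJ.
by case/imsetP=> z _ ->; exact: coord_in cD z.
Qed.

Lemma daisy_restriction (G : sgraph) (a b : G) :
  daisy_cube G -> adj a b -> daisy_cube (restriction a b).
Proof.
move=> /star_of_daisy[n [D [c [cD stD _]]]] /(coord_adj cD)[i cb].
have gD := star_geodesic stD.
have cR := coordinates_restriction cD gD cb.
have stR := star_restriction (i := i) (e := c a i) stD.
apply: (daisy_of_star cR stR).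
have ha : a \in halfspace a b by rewrite (halfspace_coord cD gD cb).
by apply/card_gt0P; exists (exist _ a ha).
Qed.

Lemma contraction_gt0 (G : sgraph) (a b : G) : 0 < #|contraction a b|.
Proof.
pose A := [set y in [set: G] | connect (class_adj a b) a y].
have PA : A \in contr_parts a b by exact: imset_f.
by apply/card_gt0P; exists (exist _ A PA).
Qed.

Lemma daisy_contraction (G : sgraph) (a b : G) :
  daisy_cube G -> adj a b -> daisy_cube (contraction a b).
Proof.
move=> /star_of_daisy[n [D [c [cD stD _]]]] /(coord_adj cD)[i cb].
have [c' cD'] := coordinates_contraction cD (star_geodesic stD) cb.
exact: daisy_of_star cD' (star_contraction (i := i) stD) (contraction_gt0 a b).
Qed.

(** Isomorphic copies of [G] carry the same coordinates, and daisy cubes are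
    closed under pc-minors, so a sequence of operations that leads away from [G]
    is decided by its first step leaving the isomorphism class of [G]. *)
Lemma pc_minor_daisy (I : finType) (G : sgraph) (D : {set {ffun I -> bool}})
    (c : G -> {ffun I -> bool}) :
  coordinates D c -> geodesic D ->
  (forall i e, exists b, star b [set x in D | x i == e]) ->
  (forall i, exists b, star b (proj i @: D)) ->
  forall H, pc_minor G H -> isomorphic H G \/ daisy_cube H.
Proof.
move=> cD gD restrD contrD H; elim=> {H} [|H a b _ [isoH|dH] ab|H a b _ [isoH|dH] ab].
- by left; exists id => //; exists id.
- right; have [c' cH] := coordinates_isomorphic isoH cD.
  have [i cb] := coord_adj cH _ _ ab; have [u stu] := restrD i (c' a i).
  apply: daisy_of_star (coordinates_restriction cH gD cb) stu _.
  have ha : a \in halfspace a b by rewrite (halfspace_coord cH gD cb).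
  by apply/card_gt0P; exists (exist _ a ha).
- by right; exact: daisy_restriction.
- right; have [c' cH] := coordinates_isomorphic isoH cD.
  have [i cb] := coord_adj cH _ _ ab; have [u stu] := contrD i.
  have [d dH] := coordinates_contraction cH gD cb.
  exact: daisy_of_star dH stu (contraction_gt0 a b).
by right; exact: daisy_contraction.
Qed.

(** * The isometric dimension *)

Section Idim.
Variables (I : finType) (G : sgraph) (D : {set {ffun I -> bool}}).
Variable c : G -> {ffun I -> bool}.
Hypotheses (cD : coordinates D c) (gD : geodesic D).

(* The directions flipped by the edge e: a singleton, which names its class. *)
Let dirs (e : {set G}) : {set I} :=
  [set i | [exists x in e, exists y in e, c x i != c y i]].

Let dirs_edge a b i : c b = flip (c a) i -> dirs [set a; b] = [set i].
Proof.
move=> cb; apply/setP=> j; rewrite !inE; apply/existsP/eqP=> [[x]|->].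
  rewrite !inE => /andP[x_ab /existsP[y]]; rewrite !inE => /andP[y_ab].
  case/orP: x_ab => /eqP->; case/orP: y_ab => /eqP->; rewrite ?eqxx // cb flipE;
    by have [->|_] := eqVneq j i; rewrite // addbF eqxx.
exists a; rewrite !inE eqxx /=; apply/existsP; exists b.
by rewrite !inE eqxx orbT cb flipE eqxx; case: (c a i).
Qed.

Let edge_dir e x y : e \in edges G -> e = [set x; y] -> exists i, c y = flip (c x) i.
Proof.
case/imsetP=> -[a b]; rewrite inE /= => ab -> exy; apply/(coord_adj cD).
have nab : a != b by apply: contraTneq ab => ->; rewrite adj_irr.
have : a \in [set x; y] by rewrite -exy !inE eqxx.
have : b \in [set x; y] by rewrite -exy !inE eqxx orbT.
have : x \in [set a; b] by rewrite exy !inE eqxx.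
have : y \in [set a; b] by rewrite exy !inE eqxx orbT.
rewrite !inE => /orP[]/eqP-> /orP[]/eqP->; rewrite // ?(adj_sym b) //.
  by rewrite !orbb => /eqP eba; rewrite eba eqxx in nab.
by rewrite !orbb => _ /eqP eba; rewrite eba eqxx in nab.
Qed.

Let edgeP e : e \in edges G -> exists a b i, e = [set a; b] /\ c b = flip (c a) i.
Proof.
move=> Ge; have /imsetP[[a b] _ /= defe] := Ge; exists a, b.
by have [i cb] := edge_dir Ge defe; exists i.
Qed.

Let edge_thetaE : {in edges G &, forall e f, edge_theta e f = (dirs e == dirs f)}.
Proof.
move=> e f Ge Gf; apply/existsP/eqP=> [[p /existsP[q /and3P[/eqP ep /eqP fq pq]]]|].
  have [i cp] := edge_dir Ge ep; have [j cq] := edge_dir Gf fq.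
  rewrite ep fq (dirs_edge cp) (dirs_edge cq); congr [set _].
  move: pq; rewrite (theta_coord cD gD _ _ cp) cq flipE.
  by have [//|_] := eqVneq i j; rewrite addbF eqxx.
have [a [b [i [-> cb]]]] := edgeP Ge; have [u [v [j [-> cv]]]] := edgeP Gf.
rewrite (dirs_edge cb) (dirs_edge cv) => /set1_inj eij.
exists (a, b); apply/existsP; exists (u, v); rewrite !eqxx /=.
by rewrite (theta_coord cD gD _ _ cb) cv eij flipE eqxx; case: (c u j).
Qed.

Lemma idim_coordinates :
  (forall i, exists2 x, x \in D & flip x i \in D) -> idim G = #|I|.
Proof.
move=> used; have -> : #|I| = #|dirs @: edges G|.
  rewrite -cardsT -(card_imset _ set1_inj); congr #|pred_of_set _|.
  apply/setP=> J; apply/imsetP/imsetP=> [[i _ ->]|[e Ge ->]].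
    have [x Dx Dxi] := used i; have [a ca] := coord_onto cD Dx.
    have [b cb] := coord_onto cD Dxi; rewrite ca in cb.
    exists [set a; b]; last by rewrite (dirs_edge (esym cb)).
    apply/imsetP; exists (a, b) => //; rewrite inE.
    by apply/(coord_adj cD); exists i.
  have [a [b [i [-> cb]]]] := edgeP Ge.
  by exists i; rewrite // (dirs_edge cb).
pose cls J := [set f in edges G | J == dirs f].
have clsE : theta_classes G = cls @: (dirs @: edges G).
  rewrite -imset_comp; apply: eq_in_imset => e Ge; apply/setP=> f.
  rewrite !inE; case Gf: (f \in edges G) => //=; exact: edge_thetaE.
rewrite /idim clsE card_in_imset // => _ _ /imsetP[e Ge ->] /imsetP[f Gf ->].
by move/setP/(_ e); rewrite !inE Ge eqxx => /esym/eqP.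
Qed.

End Idim.

(** * The set of vectors modelling the graphs M *)

Lemma exists_notin (I : finType) (A : {set I}) : #|A| < #|I| -> exists i, i \notin A.
Proof.
move=> lt_A; have /card_gt0P[i] : 0 < #|~: A| by rewrite cardsCs setCK subn_gt0.
by rewrite inE; exists i.
Qed.

Lemma neq_negb (a b : bool) : a != b -> a = ~~ b.
Proof. by case: a b => -[]. Qed.

Section Ladder.
Variables r s : nat.

(** The two coordinates of the $j$-th factor $P_3$ tell whether the vertex is
    nonzero, at [inl (j, false)], and whether it is 2, at [inl (j, true)]. *)
Definition axis : finType := (('I_r * bool) + 'I_s)%type.
Implicit Types (x y z : {ffun axis -> bool}) (i : axis) (e : bool).

Definition cst e : {ffun axis -> bool} := [ffun=> e].

Definition Bset : {set {ffun axis -> bool}} :=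
  [set x : {ffun axis -> bool} | [forall j, x (inl (j, true)) ==> x (inl (j, false))]].

Definition Mset : {set {ffun axis -> bool}} := Bset :\: [set cst e | e : bool].

Lemma card_axis : #|axis| = 2 * r + s.
Proof. by rewrite card_sum card_prod card_bool !card_ord mulnC. Qed.

Lemma BsetP x :
  reflect (forall j, x (inl (j, true)) -> x (inl (j, false))) (x \in Bset).
Proof. by rewrite inE; apply: (iffP forallP) => h j; apply/implyP; apply: h. Qed.

Lemma MsetP x : reflect (x \in Bset /\ forall e, x != cst e) (x \in Mset).
Proof.
rewrite in_setD; apply: (iffP andP) => -[]; last first.
  by move=> -> x_cst; split=> //; apply/imsetP=> -[e _]; apply/eqP.
by move=> x_cst ->; split=> // e; apply: contra x_cst => /eqP->; exact: imset_f.
Qed.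

(** The implication that defines [Bset] and its contrapositive at once: exchanging
    the corners of the grid exchanges the two coordinates of every $P_3$, so most
    arguments below treat both corners together through the value [e]. *)
Lemma Bset_eq x j e : x \in Bset -> x (inl (j, e)) = e -> x (inl (j, ~~ e)) = e.
Proof.
move=> /BsetP/(_ j); case: e => /= xj; first by move=> xt; apply: xj.
by move=> xf; apply/negbTE/negP=> /xj; rewrite xf.
Qed.

Lemma neq_cst x i e : x i != e -> x != cst e.
Proof. by apply: contraNneq => ->; rewrite ffunE. Qed.

(** If flipping one coordinate of a $P_3$ breaks its implication, then the other
    coordinate differs in the same way and can be flipped first: between 0 and 2
    the path passes through 1. *)
Lemma Bset_step x y i : x \in Bset -> y \in Bset -> x i != y i ->
  exists i', [/\ x i' = x i, y i' = y i & flip x i' \in Bset].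
Proof.
move=> Bx By; case: i => [[j b]|k] xyi; last first.
  exists (inr k); split=> //; apply/BsetP=> j; rewrite !flipE /= !addbF.
  exact: (BsetP _ Bx).
have Bflip b' : x (inl (j, ~~ b')) = b' -> flip x (inl (j, b')) \in Bset.
  move=> xb'; apply/BsetP=> j'; rewrite !flipE.
  have [-> | nj] := eqVneq j' j; last first.
    have neq d : (inl (j', d) == inl (j, b') :> axis) = false.
      by apply/eqP=> -[ej _]; rewrite ej eqxx in nj.
    by rewrite !neq !addbF; move/BsetP: Bx => /(_ j').
  have eqd d : (inl (j, d) == inl (j, b') :> axis) = (d == b').
    by apply/eqP/eqP=> [[]|->].
  rewrite !eqd {eqd}; move/BsetP: Bx => /(_ j).
  by case: b' xb' => /= ->; rewrite ?addbF ?addbT; case: (x _).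
have [xb|xb] := eqVneq (x (inl (j, ~~ b))) b.
  by exists (inl (j, b)); split=> //; exact: Bflip.
have {}xb := neq_negb xb; have xb' := Bset_eq Bx xb; rewrite negbK in xb'.
have yb : y (inl (j, b)) = b.
  by rewrite xb' eq_sym in xyi; rewrite (neq_negb xyi) negbK.
exists (inl (j, ~~ b)); split; first by rewrite xb xb'.
  by rewrite yb; exact: Bset_eq.
by apply: Bflip; rewrite negbK.
Qed.

(** A step can only fail by reaching a removed corner; then [x] is next to that
    corner.  Since [y] is not the corner, some step in the opposite
    direction exists too, and it cannot reach the opposite corner, which is at
    distance at least 3 from the first one. *)
Lemma Mset_geodesic : 2 < #|axis| -> geodesic Mset.
Proof.
move=> gt2 x y /MsetP[Bx x_cst] /MsetP[By y_cst] xy.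
have step i : x i != y i -> exists i', [/\ x i' = x i, y i' = y i,
    flip x i' \in Bset & flip x i' != cst (~~ x i) -> flip x i' \in Mset].
  move=> xyi; have [i' [xi' yi' Bi']] := Bset_step Bx By xyi.
  exists i'; split=> // ni'; apply/MsetP; split=> // e.
  have [->|ne] := eqVneq e (~~ x i); first by [].
  by apply: (neq_cst (i := i')); rewrite flipE eqxx xi'; case: (x i) e ne => -[].
have [i xyi _] := geodesicT (in_setT x) (in_setT y) xy.
have [i' [xi' yi' Bi' Mi']] := step i xyi.
have [ci|/Mi' ?] := eqVneq (flip x i') (cst (~~ x i)); last first.
  by exists i'; rewrite // xi' yi'.
have xE l : l != i' -> x l = ~~ x i.
  by move=> nl; move/ffunP/(_ l): ci; rewrite flipE ffunE (negbTE nl) addbF.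
have [l yl] : exists l, y l != ~~ x i.
  have /eqP ny := y_cst (~~ x i); apply/existsP; rewrite -negb_forall.
  by apply/forallP=> ey; apply: ny; apply/ffunP=> l; rewrite ffunE; apply/eqP.
have nl : l != i'.
  by apply: contraNneq yl => ->; rewrite yi' (neq_negb xyi) negbK.
have xyl : x l != y l by rewrite (xE l nl) eq_sym.
have [l' [xl' yl' Bl' Ml']] := step l xyl.
exists l'; first by rewrite xl' yl'.
apply: Ml'; have nl' : l' != i'.
  apply/eqP=> el; have := xE l nl; rewrite -xl' el xi'.
  by case: (x i).
have [m] : exists m, m \notin [set i'; l'].
  by apply: exists_notin; rewrite cards2 (leq_ltn_trans _ gt2) // ltnS leq_b1.
rewrite !inE negb_or => /andP[mi ml].
apply: (neq_cst (i := m)).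
by rewrite flipE (negbTE ml) addbF (xE m mi) (xE l nl); case: (x i).
Qed.

(** After restriction to [x i = e] only the corner [cst e] is missing.  At the
    middle vertex of a $P_3$ one coordinate has the value [e] and the other the
    value [~~ e], so a vector between this base and [x] can have [e] in both only
    if [x] does; the hypercube coordinates of the base, equal to [~~ e], have the
    same effect.  Thus a vector in between is the corner only if [x] is. *)
Definition restr_base i e : {ffun axis -> bool} :=
  [ffun l => if l == i then e else if l is inl (_, b) then ~~ b else ~~ e].

Lemma betweenP x y z i : between x y z -> z i = x i \/ z i = y i.
Proof. by move=> /forallP/(_ i)/orP[]/eqP->; [left|right]. Qed.

Lemma between_neq u x y i e : between u x y -> y i = e -> u i = ~~ e -> x i = e.
Proof.
by move=> /betweenP-/(_ i)[] -> // -> ; case: e.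
Qed.

Lemma Mset_restriction i e : star (restr_base i e) [set x in Mset | x i == e].
Proof.
move=> x y; rewrite inE => /andP[/MsetP[Bx x_cst] /eqP xi] bxy.
have yi : y i = e by case: (betweenP i bxy) => ->; rewrite // ffunE eqxx.
rewrite inE yi eqxx andbT; apply/MsetP.
have xy l b : y l = b -> (if l is inl (_, b') then ~~ b' else ~~ e) = ~~ b -> x l = b.
  move=> yl; have [el|nl] := eqVneq l i; first by rewrite el xi -yi -el.
  by move=> ul; apply: (between_neq bxy yl); rewrite ffunE (negbTE nl).
split.
  apply/BsetP=> j yt; apply: contraTT isT => /negbTE yf.
  have xt := xy _ _ yt erefl; have := BsetP _ Bx j xt.
  have [ei|ni] := eqVneq (inl (j, false)) i.
    by rewrite ei xi -yi -ei yf.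
  case: (betweenP (inl (j, false)) bxy) => [|<-]; last by rewrite yf.
  by rewrite yf ffunE (negbTE ni).
move=> e'; apply: contra_neq (x_cst e') => ye; apply/ffunP=> l; rewrite ffunE.
have {}ye l' : y l' = e' by rewrite ye ffunE.
have ee' : e = e' by rewrite -yi ye.
case: l => [[j b]|k]; last by apply: xy; rewrite ?ye ?ee'.
have xe : x (inl (j, e')) = e' by apply: xy.
have [->//|nb] := eqVneq b e'.
by rewrite (neq_negb nb) Bset_eq.
Qed.

(** Contracting a hypercube coordinate restores both corners.  Contracting a
    coordinate of a $P_3$ turns this $P_3$ into an edge and restores one of the
    corners; for [i = inl (j, b)] the corner [cst (~~ b)] stays missing. *)
Lemma Mset_contraction i : 1 < #|axis| -> exists b, star b (proj i @: Mset).
Proof.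
move=> gt1; pose k0 := if i is inl (_, b) then b else false.
pose u : {ffun axis -> bool} := [ffun l => if l is inl (_, b) then ~~ b else k0].
exists (proj i u) => _ y /imsetP[x /MsetP[Bx x_cst] ->] bxy.
have yi : y i = false by case: (betweenP i bxy) => ->; rewrite projE eqxx.
(* The value at i of a preimage z of y.  On a coordinate of a P_3 the
   implication always permits it, and z is constant only if y comes from the
   corner that stays missing; on a hypercube coordinate it prevents z from being
   constant. *)
pose e := if i is inl (_, b) then ~~ b else [forall l, (l != i) ==> ~~ y l].
pose z : {ffun axis -> bool} := [ffun l => if l == i then e else y l].
have xy l b : l != i -> y l = b -> u l = ~~ b -> x l = b.
  move=> nl yl ul; have := between_neq (i := l) bxy yl.
  by rewrite !projE nl; apply.
apply/imsetP; exists z; last first.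
  by apply/ffunP=> l; rewrite projE ffunE; case: eqVneq => // ->; rewrite yi.
have zi : z i = e by rewrite ffunE eqxx.
have zE l : l != i -> z l = y l by move=> nl; rewrite ffunE (negbTE nl).
apply/MsetP; split.
  apply/BsetP=> j; have [ei|nt] := eqVneq (inl (j, true)) i.
    by rewrite ei zi /e -ei.
  have [ei|nf] := eqVneq (inl (j, false)) i; first by rewrite ei zi /e -ei.
  rewrite !zE // => yt; case: (betweenP (inl (j, false)) bxy) => ->; rewrite projE nf.
    by rewrite ffunE.
  by apply: (BsetP _ Bx); apply: xy; rewrite ?ffunE.
move=> e'; apply/eqP=> ze; have {}ze l : z l = e' by rewrite ze ffunE.
have ye l : l != i -> y l = e by move=> nl; rewrite -zE // ze -zi ze.
have [l0] : exists l, l \notin [set i] by apply: exists_notin; rewrite cards1.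
rewrite inE => nl0; move: @e @k0 @u xy ye {z zi zE ze bxy yi}.
case: i nl0 => [[j b]|k] nl0 /= xy ye; last first.
  have := ye l0 nl0; case: forallP => [yf|nyf].
    by have := yf l0; rewrite nl0 => /negbTE->.
  move=> _; apply: (nyf) => l; apply/implyP=> /ye.
  by case: forallP => [/nyf|_ ->].
have xd j' : x (inl (j', ~~ b)) = ~~ b.
  have nj' : inl (j', ~~ b) != inl (j, b) :> axis.
    by rewrite (inj_eq inl_inj) xpair_eqE negb_and orbC; case: (b).
  by apply: xy; rewrite ?ye // ffunE.
have /eqP[] := x_cst (~~ b); apply/ffunP=> -[[j' b']|k]; rewrite ffunE; last first.
  by apply: xy; rewrite ?ye // ffunE negbK.
have [->//|nb] := eqVneq b' (~~ b).
by rewrite (neq_negb nb) Bset_eq.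
Qed.

(** A $P_3$ is a daisy cube with its middle vertex as base, and the two corners
    are maximal with respect to the base made of these. *)
Lemma Mset_star_no_cube : s = 0 -> exists b, star b Mset.
Proof.
move=> s0; exists [ffun l : axis => if l is inl (_, b) then ~~ b else false].
move=> x y /MsetP[Bx x_cst] bxy; apply/MsetP; split.
  apply/BsetP=> j yt; have xt : x (inl (j, true)) = true.
    by apply: (between_neq bxy yt); rewrite ffunE.
  case: (betweenP (inl (j, false)) bxy) => ->; first by rewrite ffunE.
  exact: (BsetP _ Bx).
move=> e; apply: contra_neq (x_cst e) => ye; apply/ffunP=> l; rewrite ffunE.
have {}ye l' : y l' = e by rewrite ye ffunE.
case: l => [[j b]|k]; last by have := ltn_ord k; rewrite [X in _ < X]s0.
have xe : x (inl (j, e)) = e by apply: (between_neq bxy (ye _)); rewrite ffunE.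
have [->//|nb] := eqVneq b e.
by rewrite (neq_negb nb) Bset_eq.
Qed.

(** With a hypercube coordinate [k], any would-be base [b] agrees at [k] with
    one of the two missing corners; the neighbour of that corner along [k]
    survives and has the missing corner between itself and [b]. *)
Lemma Mset_not_star b : 0 < s -> 1 < #|axis| -> ~ star b Mset.
Proof.
move=> s_gt0 gt1 st; pose k : axis := inr (Ordinal s_gt0); pose e := b k.
have [l] : exists l, l \notin [set k] by apply: exists_notin; rewrite cards1.
rewrite inE => nl.
have /MsetP[_ /(_ e)] : cst e \in Mset; last by rewrite eqxx.
apply: (st (flip (cst e) k)).
  apply/MsetP; split; first by apply/BsetP=> j; rewrite !flipE !ffunE.
  move=> e'; have [->|ne] := eqVneq e' e.
    by apply: (neq_cst (i := k)); rewrite flipE eqxx ffunE; case: (e).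
  by apply: (neq_cst (i := l)); rewrite flipE (negbTE nl) ffunE addbF eq_sym.
apply/forallP=> m; rewrite flipE ffunE; have [->|_] := eqVneq m k; first by rewrite eqxx.
by rewrite addbF eqxx orbT.
Qed.

Lemma restr_base_in i e : 0 < s -> 1 < #|axis| -> restr_base i e \in Mset.
Proof.
move=> s_gt0 gt1; apply/MsetP; split.
  apply/BsetP=> j; rewrite !ffunE /=.
  have [<-|_] := eqVneq (inl (j, true)) i; last by [].
  by case: eqP => [[]|].
move=> e'; have [->|ne] := eqVneq e' e; last first.
  by apply: (neq_cst (i := i)); rewrite ffunE eqxx eq_sym.
have [l nl] : exists l, l \notin [set i] by apply: exists_notin; rewrite cards1.
have [m nm me] : exists2 m, m != i & (if m is inl (_, b) then ~~ b else ~~ e) = ~~ e.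
  pose k : axis := inr (Ordinal s_gt0); have [ek|nk] := eqVneq k i; last by exists k.
  rewrite inE in nl; case: l nl => [[j b]|k'] nl; last by exists (inr k').
  by exists (inl (j, e)); rewrite // -ek.
by apply: (neq_cst (i := m)); rewrite ffunE (negbTE nm) me; case: (e).
Qed.

Lemma Mset_used i : 0 < s -> 2 < #|axis| -> exists2 x, x \in Mset & flip x i \in Mset.
Proof.
move=> s_gt0 gt2; have gt1 := ltnW gt2.
apply: (geodesic_flip (Mset_geodesic gt2) (restr_base_in i true s_gt0 gt1)
  (restr_base_in i false s_gt0 gt1)).
by rewrite !ffunE eqxx.
Qed.

End Ladder.

(** * The graphs M in coordinates *)

Section Model.
Variables r s : nat.

Definition B_coord (u : B r s) : {ffun axis r s -> bool} :=
  [ffun l : axis r s =>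
     match l with inl (j, b) => (b : nat) < u.1 j | inr k => u.2 k end].

Lemma B_coord_inl u j (b : bool) : B_coord u (inl (j, b)) = (b < u.1 j).
Proof. by rewrite ffunE. Qed.

Lemma B_coord_inr u k : B_coord u (inr k) = u.2 k.
Proof. by rewrite ffunE. Qed.

Definition P3_dist (a b : 'I_3) : nat := ((0 < a) != (0 < b)) + ((1 < a) != (1 < b)).

Lemma P3_dist_eq0 a b : (P3_dist a b == 0) = (a == b).
Proof. by case: a b => [[|[|[|a]]] lt_a] [[|[|[|b]]] lt_b]. Qed.

Lemma P3_dist_eq1 a b : (P3_dist a b == 1) = P3_adj a b.
Proof. by case: a b => [[|[|[|a]]] lt_a] [[|[|[|b]]] lt_b]. Qed.

Lemma ham_B_coord u v : ham (B_coord u) (B_coord v) =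
  \sum_j P3_dist (u.1 j) (v.1 j) + ham u.2 v.2.
Proof.
rewrite !ham_sum big_sumType /=; congr (_ + _); last first.
  by apply: eq_bigr => k _; rewrite !B_coord_inr.
rewrite (eq_bigr (fun l : 'I_r * bool =>
  (l.2 < u.1 l.1) != (l.2 < v.1 l.1) : nat)); last first.
  by move=> [j b] _; rewrite !B_coord_inl.
rewrite -(pair_bigA _ (fun j (b : bool) => ((b < u.1 j) != (b < v.1 j)) : nat)) /=.
by apply: eq_bigr => j _; rewrite big_bool /= addnC.
Qed.

Lemma sum_P3_dist_eq0 (f g : boxpow P3 r) :
  (\sum_j P3_dist (f j) (g j) == 0) = (f == g).
Proof.
rewrite sum_nat_eq0; apply/forallP/eqP=> [fg|-> j]; last by rewrite /= P3_dist_eq0.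
by apply/ffunP=> j; apply/eqP; rewrite -P3_dist_eq0; exact: (fg j).
Qed.

Lemma B_coord_inj : injective B_coord.
Proof.
move=> [f g] [f' g'] e; have := hamxx (B_coord (f, g)).
rewrite {2}e ham_B_coord /= => /eqP; rewrite addn_eq0 sum_P3_dist_eq0 ham_eq0.
by case/andP=> /eqP-> /eqP->.
Qed.

Lemma adj_B_coord u v : adj u v = (ham (B_coord u) (B_coord v) == 1).
Proof.
case: u v => [f g] [f' g']; rewrite ham_B_coord /=.
have -> : (\sum_j P3_dist (f j) (f' j) + ham g g' == 1) =
   (\sum_j P3_dist (f j) (f' j) == 1) && (ham g g' == 0) ||
   (\sum_j P3_dist (f j) (f' j) == 0) && (ham g g' == 1).
  by case: (\sum_j _) (ham g g') => [|[|m]] [|[|n]] //; rewrite addnS.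
rewrite ham_eq0 sum_P3_dist_eq0; congr (_ && _ || _).
apply/existsP/sum_nat_eq1=> [[j /andP[fj /forallP fg]]|[j [_ fj fg]]]; exists j.
  split=> //; first by apply/eqP; rewrite P3_dist_eq1.
  by move=> k nkj _; apply/eqP; rewrite P3_dist_eq0; exact: implyP (fg k) nkj.
apply/andP; split; first by have /eqP := fj; rewrite P3_dist_eq1.
by apply/forallP=> k; apply/implyP=> nkj; rewrite -P3_dist_eq0 fg.
Qed.

Lemma coordinates_B : coordinates (Bset r s) B_coord.
Proof.
split; [exact: B_coord_inj | exact: adj_B_coord |].
move=> x; apply/codomP/idP=> [[u ->]|/BsetP Bx].
  by apply/BsetP=> j; rewrite !B_coord_inl; exact: ltnW.
pose f : boxpow P3 r := [ffun j => inord (x (inl (j, false)) + x (inl (j, true)))].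
exists (f, [ffun k => x (inr k)]); apply/ffunP=> -[[j b]|k]; last first.
  by rewrite B_coord_inr ffunE.
rewrite B_coord_inl ffunE /= inordK; last by case: (x _) (x _) => -[].
by have := Bx j; case: b; case: (x _); case: (x _) => // ->.
Qed.

Lemma coordinates_M :
  exists c : M r s -> {ffun axis r s -> bool}, coordinates (Mset r s) c.
Proof.
have := coordinates_induced (A := ~: [set B_bot r s; B_top r s])
  (E := ~: [set cst r s e | e : bool]) coordinates_B _.
rewrite -setDE => H; eexists; apply: H => u.
rewrite !in_setC !inE; congr (~~ _).
have cst_false : cst r s false = B_coord (B_bot r s).
  by apply/ffunP=> -[[j b]|k]; rewrite ffunE ?B_coord_inl ?B_coord_inr !ffunE.
have cst_true : cst r s true = B_coord (B_top r s).
  by apply/ffunP=> -[[j b]|k]; rewrite ffunE ?B_coord_inl ?B_coord_inr !ffunE //; case: b.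
apply/orP/imsetP=> [[/eqP->|/eqP->]|[[] _]]; first by exists false.
- by exists true.
- by rewrite cst_true => /B_coord_inj->; right.
by rewrite cst_false => /B_coord_inj->; left.
Qed.

Lemma card_M : 0 < r + s -> #|M r s| = 3 ^ r * 2 ^ s - 2.
Proof.
move=> gt0; rewrite card_sig cardsCs setCK cards2.
rewrite card_prod !card_ffun card_bool !card_ord.
suff -> : B_bot r s != B_top r s by [].
apply/eqP=> -[/ffunP e1 /ffunP e2]; case: (posnP r) => [r0|r_gt0].
  have s_gt0 : 0 < s by rewrite r0 in gt0.
  by have := e2 (Ordinal s_gt0); rewrite !ffunE.
by have /(congr1 val) := e1 (Ordinal r_gt0); rewrite !ffunE.
Qed.

End Model.

(** * Membership in the class of minimal non-daisy partial cubes *)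

Lemma M_in_O_D r s : inA r s -> O_D (M r s).
Proof.
case=> s_gt0 gt2; have [c cM] := coordinates_M r s.
have gt2' : 2 < #|axis r s| by rewrite card_axis.
have gM := Mset_geodesic gt2'; have gt1 := ltnW gt2'.
split.
- apply: (partial_cube_coordinates cM gM).
  pose i : axis r s := inr (Ordinal s_gt0).
  have [v _] := coord_onto cM (restr_base_in i true s_gt0 gt1).
  by apply/card_gt0P; exists v.
- by move=> /(daisy_star cM gM)[b]; exact: Mset_not_star.
move=> H GH niso; case: (pc_minor_daisy cM gM _ _ GH) => //.
  by move=> i e; exists (restr_base i e); exact: Mset_restriction.
by move=> i; exact: Mset_contraction.
Qed.

(** Outside the family either there is no hypercube factor and the graph is a
    daisy cube, or it is one of the two degenerate cases: the empty graph
    $M_{0,1}$ and the disconnected graph $M_{0,2}$. *)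
Lemma O_D_inA r s : 0 < r + s -> O_D (M r s) -> inA r s.
Proof.
move=> rs_gt0 [[M_gt0 M_conn _] nodaisy _]; have [c cM] := coordinates_M r s.
case: (posnP s) => [s0|s_gt0].
  have [b stb] := Mset_star_no_cube r s0.
  by case: nodaisy; exact: daisy_of_star cM stb M_gt0.
split=> //; rewrite leqNgt; apply/negP=> lt3.
have r0 : r = 0 by lia.
have card_M_eq := card_M rs_gt0.
have s_eq : s = 1 \/ s = 2 by lia.
case: s_eq => es; subst r s; first by rewrite card_M_eq in M_gt0.
have /card_gt1P[x [y [_ _ xy]]] : 1 < #|M 0 2| by rewrite card_M_eq.
have /connectP[[|z p] /=] := M_conn x y; first by move=> _ exy; rewrite exy eqxx in xy.
case/andP=> /(coord_adj cM)[i cz] _ _.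
have /MsetP[_ x_cst] := coord_in cM x; have /MsetP[_] := coord_in cM z.
(* With two coordinates in all, flipping one coordinate of a non-constant
   vector gives a constant one. *)
have two (j k : axis 0 2) : j != i -> k != i -> j = k.
  case: i j k {cz} => [[[]]|i] // [[[]]|j] // [[[]]|k] //.
  case: i j k => [[|[|//]] ?] [[|[|//]] ?] [[|[|//]] ?] //= _ _; congr inr;
    exact: val_inj.
move/(_ (~~ c x i))/eqP; case; apply/ffunP=> j; rewrite cz flipE ffunE.
have [->|nj] := eqVneq j i; first by rewrite addbT.
rewrite addbF; apply/eqP; apply: contraTT isT => xj.
have /eqP[] := x_cst (c x i); apply/ffunP=> k; rewrite ffunE.
have [->//|nk] := eqVneq k i.
by rewrite -(two j k nj nk) (neq_negb xj) negbK.
Qed.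

Theorem corollary26 :
  [/\ forall r s : nat, 1 <= r + s -> (O_D (M r s) <-> inA r s),
      forall r s : nat, inA r s ->
        #|M r s| = 3 ^ r * 2 ^ s - 2 /\ idim (M r s) = 2 * r + s
    & forall r s r' s' : nat, inA r s -> inA r' s' ->
        isomorphic (M r s) (M r' s') -> (r, s) = (r', s')].
Proof.
have rs_gt0 r s : inA r s -> 0 < r + s by case; lia.
split=> [r s gt0|r s Ars|r s r' s' Ars Ars' [f bij_f _]].
- by split; [exact: O_D_inA | exact: M_in_O_D].
- split; first by apply: card_M; exact: rs_gt0.
  have [s_gt0 gt2] := Ars; have [c cM] := coordinates_M r s.
  have gt2' : 2 < #|axis r s| by rewrite card_axis.
  rewrite (idim_coordinates cM (Mset_geodesic gt2')) ?card_axis // => i.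
  exact: Mset_used.
have := bij_eq_card bij_f; rewrite !card_M ?rs_gt0 // => eq_card.
have ge2 a b : inA a b -> 2 <= 3 ^ a * 2 ^ b.
  case=> b_gt0 _; rewrite -(prednK b_gt0) expnS mulnCA leq_pmulr //.
  by rewrite muln_gt0 !expn_gt0.
have {}eq_card : 3 ^ r * 2 ^ s = 3 ^ r' * 2 ^ s'.
  by have := ge2 _ _ Ars; have := ge2 _ _ Ars'; lia.
have log p a b : logn p (3 ^ a * 2 ^ b) = a * logn p 3 + b * logn p 2.
  by rewrite lognM ?expn_gt0 // !lognX.
congr (_, _).
  by have := congr1 (logn 3) eq_card; rewrite !log !logn_prime //= !muln1 !muln0 !addn0.
by have := congr1 (logn 2) eq_card; rewrite !log !logn_prime //= !muln1 !muln0.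
Qed.
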